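(* For all integers $a\ge 1$ and $n\ge 1$, the graph $\Pi^a_n$ contains a Hamiltonian path.
   Context: For integers $a\ge 1$ and $n\ge 0$, let $\mathcal{S}^a_n$ be the set of all words $\alpha_1\cdots\alpha_n$ of length $n$ over the alphabet $\{0,1,\dots,a\}$ such that the letter $a$ appears only immediately after a letter $0$ (so $\alpha_1\ne a$, and $\alpha_i=a$ implies $\alpha_{i-1}=0$). The metallic cube $\Pi^a_n$ is the simple graph with vertex set $\mathcal{S}^a_n$ in which two vertices $\alpha,\beta$ are adjacent if and only if $\sum_{k=1}^n|\alpha_k-\beta_k|=1$, i.e. one is obtained from the other by replacing a single letter $k$ by $k+1$, $0\le k\le a-1$. A Hamiltonian path is a path visiting each vertex exactly once (a one-vertex graph trivially has one). *)

(* Defs.v *)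
From HB Require Import structures.
From mathcomp Require Import all_boot all_order all_algebra.

Set Implicit Arguments.
Unset Strict Implicit.
Unset Printing Implicit Defensive.

(* Positions are counted from 0, so that position 0 has no predecessor and
   cannot carry the letter a. *)
Definition metallic_word (a n : nat) (w : n.-tuple 'I_a.+1) : bool :=
  [forall i : 'I_n, (tnth w i == a :> nat) ==>
     [exists j : 'I_n, (j.+1 == i :> nat) && (tnth w j == 0 :> nat)]].

Definition metallic_vertex (a n : nat) : Type :=
  {w : n.-tuple 'I_a.+1 | metallic_word w}.

HB.instance Definition _ (a n : nat) := SubFinite.on (metallic_vertex a n).

Definition metallic_cube (a n : nat) : rel (metallic_vertex a n) :=
  fun u v => \sum_(k < n) `|tnth (val u) k - tnth (val v) k|%N == 1.

Lemma metallic_cube_sym (a n : nat) : symmetric (@metallic_cube a n).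
Proof. by move=> u v; rewrite /metallic_cube; under eq_bigr do rewrite distnC. Qed.

Lemma metallic_cube_irr (a n : nat) : irreflexive (@metallic_cube a n).
Proof. by move=> u; rewrite /metallic_cube big1 // => i _; rewrite distnn. Qed.

(* The path is x :: p, hence it has at least one vertex. *)
Definition has_hamiltonian_path (T : finType) (e : rel T) : Prop :=
  exists (x : T) (p : seq T),
    [/\ path e x p, uniq (x :: p) & forall y : T, y \in x :: p].

(* Main.v *)
Require Import Defs.
From mathcomp Require Import all_boot all_order all_algebra.
From mathcomp Require Import zify.

(** A nonempty metallic word is either [x :: w] with [x < a] and [w] metallic,
    or [0 :: a :: w] with [w] metallic.  So the cube of dimension n + 2 consists
    of a ladder of [a] copies of the cube of dimension n + 1, copies [x] and
    [x.+1] being joined by the perfect matching [x :: w -- x.+1 :: w], together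
    with one copy of the cube of dimension n, each vertex [0 :: a :: w] of which
    is joined to the vertex [0 :: a.-1 :: w] of the bottom rung.

    Two Hamiltonian paths, [s] in dimension n and [t] in dimension n + 1, such
    that [t] ends in [a.-1] followed by the end of [s], therefore yield one in
    dimension n + 2: traverse the extra copy along [s], step down from
    [0 :: a :: last s] to [0 :: a.-1 :: last s = 0 :: last t], and climb the
    ladder, traversing [t] alternately backwards and forwards.  The new path
    ends in the top rung, at [a.-1] followed by an end of [t]; as [t] may be
    reversed, the hypothesis on ends holds for the next pair of dimensions
    ([gray_pair]).  The induction starts from the empty word and the path
    [0, ..., a.-1] of words of length 1.

    The paths are built as lists of words over the natural numbers ([gray]) and
    transported to the subtype of vertices only in the theorem. *)

Set Implicit Arguments.
Unset Strict Implicit.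
Unset Printing Implicit Defensive.

(** * Metallic words as sequences of natural numbers *)

Definition may_precede (a x y : nat) : bool := (y == a) ==> (x == 0).

(** The nonzero letter 1, placed before the word, forbids [a] in front. *)
Definition metallic (a : nat) (w : seq nat) : bool :=
  all (leq^~ a) w && path (may_precede a) 1 w.

Lemma path_may_precede (a x : nat) (w : seq nat) :
  0 < x -> path (may_precede a) x w = path (may_precede a) 1 w.
Proof.
by case: w => //= y w; rewrite /may_precede; case: x.
Qed.

Lemma metallic1 (a x : nat) : metallic a [:: x] = (x < a).
Proof. by rewrite /metallic /= /may_precede !andbT; lia. Qed.

Lemma metallic_cons2 (a x y : nat) (w : seq nat) : 0 < a ->
  metallic a [:: x, y & w] =
  ((x < a) && metallic a (y :: w))
  || [&& x == 0, y == a & metallic a w].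
Proof.
move=> a_gt0; rewrite /metallic /=.
case: (y =P a) => [->|/eqP y_neq_a].
  rewrite (path_may_precede _ _ a_gt0) /may_precede eqxx leqnn /=.
  case: a a_gt0 => // a _; case: x => [|x]; rewrite /= ?andbF //=.
rewrite /may_precede (negbTE y_neq_a) andbF orbF /=.
by case: (all _ w); case: (path _ _ w); rewrite ?andbF ?andbT //=; lia.
Qed.

Lemma metallic_nseq0 (a n : nat) : 0 < a -> metallic a (nseq n 0).
Proof.
move=> a_gt0; rewrite /metallic all_nseq orbT /=.
by elim: n 1 => //= n IHn x; rewrite IHn /may_precede andbT; case: (a) a_gt0.
Qed.

Definition l1dist (u v : seq nat) : nat :=
  \sum_(p <- zip u v) `|p.1 - p.2|%N.

Definition adj (u v : seq nat) : bool := l1dist u v == 1.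

Lemma l1dist_cons (x y : nat) (u v : seq nat) :
  l1dist (x :: u) (y :: v) = `|x - y|%N + l1dist u v.
Proof. by rewrite /l1dist /= big_cons. Qed.

Lemma l1distC : commutative l1dist.
Proof.
elim=> [|x u IHu] [|y v]; rewrite /l1dist ?big_nil //.
by rewrite -!/(l1dist _ _) !l1dist_cons IHu distnC.
Qed.

Lemma l1distnn (u : seq nat) : l1dist u u = 0.
Proof.
by elim: u => [|x u IHu]; rewrite ?l1dist_cons ?IHu ?distnn // /l1dist big_nil.
Qed.

Lemma adjC : symmetric adj.
Proof. by move=> u v; rewrite /adj l1distC. Qed.

Lemma adj_cons (x : nat) (u v : seq nat) : adj (x :: u) (x :: v) = adj u v.
Proof. by rewrite /adj l1dist_cons distnn. Qed.

Lemma adj_consS (x : nat) (u : seq nat) : adj (x :: u) (x.+1 :: u).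
Proof. by rewrite /adj l1dist_cons l1distnn addn0; lia. Qed.

(** * Climbing a ladder of copies of a path *)

Lemma sorted_cat_link (T : Type) (e : rel T) (d : T) (s t : seq T) :
  sorted e s -> sorted e t -> e (last d s) (head d t) -> sorted e (s ++ t).
Proof.
case: s t => [|x s] [|y t] //=; rewrite ?cats0 // cat_path /=.
by move=> -> -> ->.
Qed.

Lemma last_map_dflt (T U : Type) (f : T -> U) (d : T) (d' : U) (s : seq T) :
  0 < size s -> last d' (map f s) = f (last d s).
Proof. by case: s => //= x s _; rewrite last_map. Qed.

Lemma head_map_dflt (T U : Type) (f : T -> U) (d : T) (d' : U) (s : seq T) :
  0 < size s -> head d' (map f s) = f (head d s).
Proof. by case: s. Qed.

Definition orient (T : Type) (b : bool) (s : seq T) : seq T :=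
  if b then rev s else s.

Lemma size_orient (T : Type) (b : bool) (s : seq T) :
  size (orient b s) = size s.
Proof. by case: b; rewrite //= size_rev. Qed.

Lemma mem_orient (T : eqType) (b : bool) (s : seq T) : orient b s =i s.
Proof. by case: b => //= x; rewrite mem_rev. Qed.

Lemma uniq_orient (T : eqType) (b : bool) (s : seq T) :
  uniq (orient b s) = uniq s.
Proof. by case: b; rewrite //= rev_uniq. Qed.

Lemma sorted_orient (T : Type) (e : rel T) (b : bool) (s : seq T) :
  symmetric e -> sorted e (orient b s) = sorted e s.
Proof.
move=> eC; case: b => //=; rewrite rev_sorted.
by apply: eq_sorted => x y; rewrite eC.
Qed.

Lemma head_rev_last (T : Type) (d : T) (s : seq T) :
  head d (rev s) = last d s.
Proof. by case/lastP: s => // s x; rewrite rev_rcons last_rcons. Qed.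

(** Turning round between two rungs: each traversal begins where the preceding
    one, in the opposite direction, ended. *)
Lemma head_orientN (T : Type) (d : T) (b : bool) (s : seq T) :
  head d (orient (~~ b) s) = last d (orient b s).
Proof. by case: b => /=; rewrite -head_rev_last ?revK. Qed.

Fixpoint ladder (k : nat) (s : seq (seq nat)) : seq (seq nat) :=
  if k is j.+1 then ladder j s ++ map (cons j) (orient (odd j) s) else [::].

Lemma mem_ladder_cons (k x : nat) (w : seq nat) (s : seq (seq nat)) :
  (x :: w \in ladder k s) = (x < k) && (w \in s).
Proof.
elim: k => //= k IHk; rewrite mem_cat IHk ltnS [x <= k]leq_eqVlt andb_orl orbC.
congr (_ || _); apply/mapP/andP => [[v vs [-> ->]]|[/eqP-> ws]].
  by rewrite mem_orient in vs.
by exists w; rewrite ?mem_orient.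
Qed.

Lemma mem_ladder_nil (k : nat) (s : seq (seq nat)) :
  ([::] \in ladder k s) = false.
Proof. by elim: k => //= k IHk; rewrite mem_cat IHk; apply/mapP => -[]. Qed.

Lemma uniq_ladder (k : nat) (s : seq (seq nat)) : uniq s -> uniq (ladder k s).
Proof.
move=> s_uniq; elim: k => //= k IHk; rewrite cat_uniq IHk /=.
rewrite map_inj_uniq ?uniq_orient ?s_uniq ?andbT => [|u v [] //].
by apply/hasPn => _ /mapP[w _ ->]; rewrite /= mem_ladder_cons ltnn.
Qed.

Lemma head_ladder (k : nat) (s : seq (seq nat)) :
  0 < size s -> head [::] (ladder k.+1 s) = 0 :: head [::] s.
Proof.
move=> s_gt0; have s_cons: exists x p, s = x :: p by case: s s_gt0; eauto.
case: s_cons => x [p ->]; elim: k => //= k.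
by case: (ladder k _ ++ _).
Qed.

Lemma last_ladder (k : nat) (s : seq (seq nat)) : 0 < size s ->
  last [::] (ladder k.+1 s) = k :: last [::] (orient (odd k) s).
Proof.
move=> s_gt0; rewrite /= last_cat (last_map_dflt _ [::]) //.
by rewrite size_orient.
Qed.

Lemma sorted_ladder (k : nat) (s : seq (seq nat)) :
  0 < size s -> sorted adj s -> sorted adj (ladder k s).
Proof.
move=> s_gt0 s_adj; elim: k => // k IHk.
rewrite [ladder _ _]/=.
have rung_adj: sorted adj (map (cons k) (orient (odd k) s)).
  rewrite sorted_map (@eq_sorted _ _ adj) ?(sorted_orient _ _ adjC) //.
  by move=> u v; apply: adj_cons.
case: k IHk rung_adj => // k IHk rung_adj.
apply: (@sorted_cat_link _ _ [::]) => //; rewrite last_ladder //.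
rewrite (head_map_dflt _ [::]) ?size_orient // [odd _]/= head_orientN.
exact: adj_consS.
Qed.

(** * Hamiltonian paths in the metallic cubes *)

Definition gray (a n : nat) (s : seq (seq nat)) : Prop :=
  [/\ sorted adj s, uniq s &
      forall w, (w \in s) = (size w == n) && metallic a w].

Lemma gray_size_gt0 (a n : nat) (s : seq (seq nat)) :
  0 < a -> gray a n s -> 0 < size s.
Proof.
move=> a_gt0 [_ _ mem_s]; have := mem_s (nseq n 0).
by rewrite size_nseq eqxx metallic_nseq0 //; case: s {mem_s}.
Qed.

Lemma gray_orient (a n : nat) (b : bool) (s : seq (seq nat)) :
  gray a n s -> gray a n (orient b s).
Proof.
case=> s_adj s_uniq mem_s; split; rewrite ?uniq_orient //.
  by rewrite sorted_orient //; apply: adjC.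
by move=> w; rewrite mem_orient.
Qed.

Lemma gray0 (a : nat) : gray a 0 [:: [::]].
Proof. by split=> // -[]. Qed.

Lemma gray1 (a : nat) : gray a 1 (ladder a [:: [::]]).
Proof.
split; [exact: sorted_ladder | exact: uniq_ladder |].
move=> [|x [|y w]]; rewrite ?mem_ladder_nil ?mem_ladder_cons ?inE //=.
  by rewrite metallic1 andbT.
by rewrite andbF.
Qed.

(** The ladder is climbed along [rev t] because the extra copy, which is
    traversed first, is left below the end of [t]. *)
Lemma gray_step (a n : nat) (s t : seq (seq nat)) :
  0 < a -> gray a n s -> gray a n.+1 t ->
  last [::] t = a.-1 :: last [::] s ->
  gray a n.+2 (map (fun w => [:: 0, a & w]) s ++ ladder a (rev t)).
Proof.
move=> a_gt0 gs gt last_t.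
have s_gt0 := gray_size_gt0 a_gt0 gs.
have rt_gt0: 0 < size (rev t) by rewrite size_rev (gray_size_gt0 a_gt0 gt).
case: gs gt => s_adj s_uniq mem_s [t_adj t_uniq mem_t].
have rt_adj: sorted adj (rev t) by rewrite (sorted_orient true _ adjC).
split.
- apply: (@sorted_cat_link _ _ [::]); last 1 first.
  + case: a a_gt0 last_t {mem_s mem_t} => // a _ last_t.
    rewrite (last_map_dflt _ [::]) // head_ladder // head_rev_last last_t /=.
    by rewrite adj_cons adjC adj_consS.
  + rewrite sorted_map (@eq_sorted _ _ adj) // => u v /=.
    by rewrite !adj_cons.
  + exact: sorted_ladder.
- rewrite cat_uniq map_inj_uniq ?s_uniq ?uniq_ladder ?rev_uniq ?andbT //=;
    last by move=> u v [].
  (* [rev t] lists metallic words, none of which begins with [a]. *)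
  apply/hasPn => w w_ladder; apply/mapP => -[v _ w_def]; move: w_ladder.
  rewrite w_def mem_ladder_cons mem_rev mem_t /metallic /= /may_precede eqxx.
  by rewrite !andbF.
- move=> w; rewrite mem_cat.
  case: w => [|x w].
    by rewrite mem_ladder_nil orbF; apply/mapP => -[].
  rewrite mem_ladder_cons mem_rev mem_t.
  case: w => [|y w].
    by rewrite !andbF orbF; apply/mapP => -[].
  rewrite metallic_cons2 // orbC andb_orr /= !eqSS andbCA; congr (_ || _).
  apply/mapP/idP => [[v v_s [-> -> ->]]|].
    by move: v_s; rewrite mem_s !eqxx.
  move=> /and4P[w_size /eqP-> /eqP-> w_met].
  by exists w; rewrite // mem_s w_size.
Qed.

(** The condition on the last words makes the induction go through: the path
    built by [gray_step] satisfies it with respect to [t] or its reverse,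
    depending on the parity of [a]. *)
Lemma gray_pair (a n : nat) : 0 < a ->
  exists s t, [/\ gray a n s, gray a n.+1 t &
                  last [::] t = a.-1 :: last [::] s].
Proof.
move=> a_gt0; elim: n => [|n [s [t [gs gt last_t]]]].
  exists [:: [::]], (ladder a [:: [::]]); split; [exact: gray0|exact: gray1|].
  by case: a a_gt0 => // a _; rewrite last_ladder //=; case: (odd a).
exists (orient (odd a.-1) (rev t)).
exists (map (fun w => [:: 0, a & w]) s ++ ladder a (rev t)); split.
- by apply/gray_orient/(gray_orient true).
- exact: gray_step.
- have rt_gt0: 0 < size (rev t) by rewrite size_rev (gray_size_gt0 a_gt0 gt).
  case: a a_gt0 {gs gt last_t} => // a _.
  have := last_ladder a rt_gt0; rewrite last_cat.
  (* [last_cat] makes the end of the extra copy the default of [last]; the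
     head of the ladder shows that the ladder is nonempty. *)
  case: (ladder _ _) (head_ladder a rt_gt0) => //.
Qed.

(** * Transport to the vertices of the cube *)

Definition letters (a n : nat) (v : metallic_vertex a n) : seq nat :=
  map val (val (val v)).

Lemma letters_inj (a n : nat) : injective (@letters a n).
Proof. by move=> u v /(inj_map val_inj)/val_inj/val_inj. Qed.

Lemma adj_letters (a n : nat) (u v : metallic_vertex a n) :
  adj (letters u) (letters v) = metallic_cube u v.
Proof.
rewrite /adj /l1dist /metallic_cube /letters; congr (_ == 1).
rewrite (big_nth (0, 0)) size_zip !size_map !size_tuple minnn big_mkord.
apply: eq_bigr => k _; rewrite nth_zip ?size_map ?size_tuple //=.
by rewrite !(nth_map ord0) ?size_tuple // -!tnth_nth.
Qed.

Lemma metallic_tuple (a n : nat) (w : n.-tuple 'I_a.+1) :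
  metallic a (map val w) = metallic_word w.
Proof.
have nth_w (i : 'I_n): nth 0 (map val w) i = tnth w i.
  by rewrite (nth_map ord0) ?size_tuple // -tnth_nth.
have letters_le: all (leq^~ a) (map val w).
  by rewrite all_map; apply/allP => x _; apply: (ltn_ord x).
rewrite /metallic letters_le /=.
apply/(pathP 0)/forallP => [w_path i|w_met i]; rewrite ?size_map ?size_tuple.
  have := w_path i; rewrite size_map size_tuple => /(_ (ltn_ord i)).
  rewrite /may_precede nth_w => /implyP wi; apply/implyP => /wi.
  case: i {wi} => -[|i] // i_lt /=; have j_lt := ltnW i_lt.
  rewrite (nth_w (Ordinal j_lt)) => w0.
  by apply/existsP; exists (Ordinal j_lt); rewrite /= eqxx.
move=> i_lt; apply/implyP; rewrite (nth_w (Ordinal i_lt)) => wi.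
have /existsP[j /andP[/eqP /= j_i wj]] := implyP (w_met (Ordinal i_lt)) wi.
by rewrite -j_i /= nth_w.
Qed.

Lemma codom_letters (a n : nat) (w : seq nat) :
  (w \in codom (@letters a n)) = (size w == n) && metallic a w.
Proof.
apply/codomP/andP => [[v ->]|[/eqP w_size w_met]].
  by rewrite size_map size_tuple eqxx metallic_tuple; split=> //; apply: valP.
pose t : n.-tuple 'I_a.+1 := [tuple inord (nth 0 w i) | i < n].
have t_w: map val t = w.
  apply: (@eq_from_nth _ 0) => [|i]; rewrite size_map size_tuple // => i_lt.
  rewrite (nth_map ord0) ?size_tuple // -(tnth_nth ord0 t (Ordinal i_lt)).
  rewrite tnth_mktuple; apply: inordK.
  case/andP: w_met => /allP letters_le _.
  by rewrite ltnS letters_le // mem_nth // w_size.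
have t_met: metallic_word t by rewrite -metallic_tuple t_w.
by exists (exist _ t t_met); rewrite /letters /= t_w.
Qed.

Theorem theorem11 (a n : nat) (ha : 1 <= a) (hn : 1 <= n) :
  has_hamiltonian_path (@metallic_cube a n).
Proof.
have [s [_ [gs _ _]]] := gray_pair n ha.
have s_gt0 := gray_size_gt0 ha gs; case: gs => s_adj s_uniq mem_s.
have s_codom: {subset s <= codom (@letters a n)}.
  by move=> w; rewrite codom_letters mem_s.
move: (map_preim s_codom); set q := preim_seq _ _ => q_s.
have mem_q v: v \in q.
  by rewrite -(mem_map (@letters_inj a n)) q_s mem_s -codom_letters codom_f.
have q_uniq: uniq q by rewrite -(map_inj_uniq (@letters_inj a n)) q_s.
have q_path: sorted (@metallic_cube a n) q.
  rewrite (@eq_sorted _ _ (relpre (@letters a n) adj)) -?sorted_map ?q_s //.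
  by move=> u v /=; rewrite adj_letters.
have q_gt0: 0 < size q by rewrite -(size_map (@letters a n)) q_s.
by case: q q_gt0 mem_q q_uniq q_path {q_s} => // x p *; exists x, p.
Qed.
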